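(* If the Riordan graph $G=G_n(g,tg)$ is io-decomposable, then $$\mathrm{diam}(G)\le\lfloor\log_2 n\rfloor.$$ In particular, if $n=2^k+2$ or $n=2^{k+1}+1$ for some $k\ge1$, then $\mathrm{diam}(G)=2$.
   Context: Power series have coefficients in $\mathbb{Z}$ (or $\mathbb{Z}_2$); $\equiv$ means congruence mod $2$; $[t^k]u$ is the coefficient of $t^k$ in $u$. For $f(0)=0$, the Riordan graph $G_n(g,f)$ is the simple graph on $[n]=\{1,\dots,n\}$ in which, for $i>j\ge1$, $i$ and $j$ are adjacent iff $[t^{i-2}]\,g f^{\,j-1}\equiv 1$. It is proper if $g(0)\equiv f'(0)\equiv1$. $\mathrm{diam}(G)$ is the maximum, over all pairs of vertices, of the number of edges in a shortest path between them. A proper Riordan graph $G_n(g,f)$, with odd vertex set $V_o$ and even vertex set $V_e$, is io-decomposable if the induced subgraph $\langle V_o\rangle\cong G_{\lceil n/2\rceil}(g,f)$ via the relabeling $2k-1\mapsto k$ and the induced subgraph $\langle V_e\rangle$ is a null graph (no edges). *)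

(* Defs.v *)
From mathcomp Require Import all_boot all_order all_algebra.

Set Implicit Arguments.
Unset Strict Implicit.
Unset Printing Implicit Defensive.

Import GRing.Theory.

(* A formal power series over Z is given by its coefficients:
   [u k] is [t^k] u, so that u(0) is [u 0]. *)
Definition fps := nat -> int.

Definition fps_one : fps := fun k => ((k == 0)%N%:R)%R.

Definition fps_X : fps := fun k => ((k == 1)%N%:R)%R.

Definition fps_mul (u v : fps) : fps :=
  fun k => (\sum_(i < k.+1) u i * v (k - i)%N)%R.

Definition fps_exp (u : fps) (m : nat) : fps := iter m (fps_mul u) fps_one.

Definition fps_deriv (u : fps) : fps := fun k => (u k.+1 *+ k.+1)%R.

(* The ordinal [x : 'I_n] stands for the vertex [x + 1] of {1, ..., n}. *)
Definition label (n : nat) (x : 'I_n) : nat := x.+1.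

(* Meaningful for i > j >= 1, where the subtractions are exact. *)
Definition riordan_entry (g f : fps) (i j : nat) : bool :=
  (fps_mul g (fps_exp f (j - 1)) (i - 2)%N == 1 %[mod 2])%Z.

Definition riordan_graph (n : nat) (g f : fps) : rel 'I_n := fun x y =>
  ((label y < label x) && riordan_entry g f (label x) (label y))
  || ((label x < label y) && riordan_entry g f (label y) (label x)).

Arguments riordan_graph n g f x y : clear implicits.

(* The condition f(0) = 0 is part of the notion of Riordan graph; it is
   recorded here because [riordan_graph] itself is defined for every f. *)
Definition riordan_proper (g f : fps) : Prop :=
  [/\ f 0 = 0%R, (g 0%N = 1 %[mod 2])%Z & (fps_deriv f 0%N = 1 %[mod 2])%Z].

Definition odd_vertices (n : nat) : {set 'I_n} := [set x | odd (label x)].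

Definition even_vertices (n : nat) : {set 'I_n} := [set x | ~~ odd (label x)].

(* [uphalf n] is the ceiling of n/2. *)
Definition io_decomposable (n : nat) (g f : fps) : Prop :=
  [/\ riordan_proper g f,
      {in odd_vertices n &, forall (x y : 'I_n) (a b : 'I_(uphalf n)),
         label x = 2 * label a - 1 -> label y = 2 * label b - 1 ->
         riordan_graph n g f x y = riordan_graph (uphalf n) g f a b}
    & {in even_vertices n &, forall x y : 'I_n, ~~ riordan_graph n g f x y}].

Section Diameter.

Variables (T : finType) (e : rel T).

Definition has_path (x y : T) (d : nat) : bool :=
  [exists p : d.-tuple T, [&& path e x p, uniq (x :: p) & last x p == y]].

(* Number of edges of a shortest path.  A path has fewer than #|T| edges, so
   [find] returns #|T|, which exceeds every genuine distance, exactly when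
   there is no path from x to y. *)
Definition dist (x y : T) : nat := find (has_path x y) (iota 0 #|T|).

Definition diam : nat := \max_(x : T) \max_(y : T) dist x y.

End Diameter.

(* Main.v *)
Require Import Defs.
From mathcomp Require Import all_boot all_order all_algebra.
From mathcomp Require Import zify.

Import GRing.Theory.

(**
Let p be g reduced modulo 2.  For f = tg and vertices numbered from 0, an
edge between y < x means that the coefficient of degree x - y - 1 in
p^(y + 1) is 1.  Comparing the edges from the first vertex to the other
vertices of odd label, io-decomposability says that [t^(2l+1)] p = [t^l] p,
which is the differential equation p' = p^2 over F_2, up to the truncation
imposed by n.

Two facts carry the proof.

- Vertex 2^s is adjacent to every smaller vertex ([bell_hub]).  By induction
  on s, halving the exponent: squaring substitutes t^2 for t, so an even power
  of p reduces to half the degree at once, and an odd power q^2 p does so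
  because (q^2 p)' = q^2 p' = (q p)^2 ([coef_halved_mul_sqr]).

- The vertices 2^s, ..., 2^(s+1) - 1 induce a copy of the graph on
  0, ..., 2^s - 1 ([bell_adj_shift]), since p^(2^s) is 1 plus terms of degree
  at least 2^s.

For the bound, take 2^s < N <= 2^(s+1) and look at the graph on 0, ..., N - 1.
Two vertices below the hub 2^s are at distance at most 2 through it; the
vertices from the hub on form a copy of the graph on N - 2^s <= N/2 vertices,
where induction applies; and one more edge, to the hub, reaches a vertex below
it.  Each halving thus costs at most one edge, which gives log_2 N
([bell_walk]).

If n = 2^k + 1 the hub is the last vertex, and if n = 2^k + 2 the only vertex
after it is its successor, to which it is also adjacent.  So the hub is adjacent
to everything and the diameter is at most 2; it is not smaller because
n >= 4 and the vertices of labels 2 and 4, both even, are not adjacent.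
*)

(** * Distances in a finite graph *)

Section Distance.

Variables (T : finType) (e : rel T).

Lemma dist_le_path (x : T) (p : seq T) :
  path e x p -> dist e x (last x p) <= size p.
Proof.
move=> ep; set y := last x p.
have [q [eq_ uq lq sq]] :
    exists q, [/\ path e x q, uniq (x :: q), last x q = y & size q <= size p].
  rewrite /y; case/shortenP: ep => q eq_ uq sub_qp; exists q; split=> //.
  by apply: uniq_leq_size => //; case/andP: uq.
have lt_q : size q < #|T|.
  by have := card_uniqP uq => /= <-; exact: max_card.
rewrite (leq_trans _ sq) // leqNgt; apply/negP => /(before_find 0).
rewrite nth_iota // add0n => /idP[].
by apply/existsP; exists (in_tuple q); rewrite eq_ uq lq eqxx.
Qed.

(** Two distinct vertices force the search bound #|T| to be at least 2, so the
    value returned when no path exists is covered as well. *)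
Lemma dist_gt1 (x y : T) : x != y -> ~~ e x y -> 1 < dist e x y.
Proof.
move=> neq_xy not_exy; rewrite ltnNge; apply/negP => le1.
have card2 : 1 < #|T|.
  by apply/card_gt1P; exists x, y.
have lt_d : dist e x y < #|T| by apply: leq_ltn_trans card2.
have /(nth_find 0) : has (has_path e x y) (iota 0 #|T|).
  by rewrite has_find size_iota.
rewrite nth_iota // add0n -/(dist e x y).
case: (dist e x y) le1 => [|[|//]] _ /existsP[[[|z [|//]] //= _]].
  by rewrite (negbTE neq_xy).
by rewrite andbT => /and3P[exz _ /eqP ezy]; rewrite -ezy exz in not_exy.
Qed.

Lemma diam_leP (d : nat) :
  reflect (forall x y, dist e x y <= d) (diam e <= d).
Proof.
rewrite /diam; apply: (iffP (bigmax_leqP _ _ _)) => [le_d x y | le_d x _].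
  by have /bigmax_leqP/(_ y isT) := le_d x isT.
by apply/bigmax_leqP.
Qed.

Lemma dist_le_diam (x y : T) : dist e x y <= diam e.
Proof. by move: x y; apply/diam_leP. Qed.

Lemma diam_universal_vertex (v : T) :
  symmetric e -> (forall x, x != v -> e v x) -> diam e <= 2.
Proof.
move=> e_sym univ; apply/diam_leP => x y.
have [-> | x_v] := eqVneq x v; have [-> | y_v] := eqVneq y v.
- exact: leq_trans (@dist_le_path v [::] isT) _.
- by apply: leq_trans (@dist_le_path v [:: y] _) _; rewrite //= univ.
- by apply: leq_trans (@dist_le_path x [:: v] _) _; rewrite //= e_sym univ.
- by apply: (@dist_le_path x [:: v; y]); rewrite /= e_sym !univ.
Qed.

End Distance.

(** * Power series modulo 2 *)

Local Notation F2P := {poly 'F_2}.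

Lemma F2_idem (c : 'F_2) : (c * c = c)%R.
Proof. by apply/eqP; case: c => [[|[|]]]. Qed.

Lemma F2P_addrr (p : F2P) : (p + p = 0)%R.
Proof. by rewrite -mulr2n -mulr_natl -polyC_natr pchar_Fp_0 ?mul0r. Qed.

(** The Frobenius endomorphism fixes the coefficients, so it only acts on the
    variable. *)
Lemma F2P_sqr (p : F2P) : (p ^+ 2 = p \Po 'X^2)%R.
Proof.
elim/poly_ind: p => [|p c IHp]; first by rewrite expr0n comp_poly0.
rewrite sqrrD mulr2n F2P_addrr addr0 exprMn IHp.
rewrite comp_polyD comp_polyM comp_polyX comp_polyC -polyC_exp.
by rewrite (expr2 c) F2_idem.
Qed.

Lemma F2P_expn2 (s : nat) (p : F2P) : (p ^+ (2 ^ s) = p \Po 'X^(2 ^ s))%R.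
Proof.
elim: s => [|s IHs]; first by rewrite expn0 !expr1 comp_polyXr.
by rewrite expnSr exprM IHs F2P_sqr -comp_polyA comp_Xn_poly -exprM mulnC.
Qed.

Lemma F2P_coef_sqr_even (p : F2P) (k : nat) : ((p ^+ 2)`_(2 * k) = p`_k)%R.
Proof. by rewrite F2P_sqr coef_comp_poly_Xn // dvdn_mulr // mulKn. Qed.

Lemma F2P_coef_sqr_odd (p : F2P) (k : nat) : ((p ^+ 2)`_(2 * k).+1 = 0)%R.
Proof. by rewrite F2P_sqr coef_comp_poly_Xn // dvdn2 /= oddM. Qed.

Lemma F2_mulrn_odd (c : 'F_2) (k : nat) : (c *+ (2 * k).+1 = c)%R.
Proof. by rewrite -mulr_natl mulrS natrM pchar_Fp_0 // mul0r addr0 mul1r. Qed.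

Lemma F2_mulrn_even (c : 'F_2) (k : nat) : (c *+ (2 * k) = 0)%R.
Proof. by rewrite -mulr_natl natrM pchar_Fp_0 // !mul0r. Qed.

(** Since p^(2^s) is a polynomial in t^(2^s) with constant term 1, multiplying
    by it does not disturb the coefficients of degree below 2^s. *)
Lemma F2P_coef_expD (p : F2P) (s m k : nat) :
  (p`_0 = 1)%R -> k < 2 ^ s -> ((p ^+ (2 ^ s + m))`_k = (p ^+ m)`_k)%R.
Proof.
move=> p0 lt_k; rewrite exprD coefM big_ord_recl big1 => [|i _].
  rewrite F2P_expn2 coef_comp_poly_Xn ?expn_gt0 // dvdn0 div0n p0.
  by rewrite mul1r addr0 subn0.
have le_i := ltn_ord i.
rewrite F2P_expn2 coef_comp_poly_Xn ?expn_gt0 // gtnNdvd ?mul0r //=.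
by rewrite /bump /=; lia.
Qed.

Lemma F2P_coef0_exp (p : F2P) (m : nat) : (p`_0 = 1)%R -> ((p ^+ m)`_0 = 1)%R.
Proof.
move=> p0; elim: m => [|m IHm]; first by rewrite coef1.
by rewrite exprS coef0M p0 IHm mulr1.
Qed.

(** The differential equation p' = p^2 modulo 2, read on coefficients: the even
    degrees of p' carry the odd coefficients of p, and those of p^2 carry all
    the coefficients of p. *)
Definition odd_coef_halved (n : nat) (p : F2P) : Prop :=
  forall l, (2 * l).+2 < n -> (p`_(2 * l).+1 = p`_l)%R.

Lemma coef_deriv_halved (n : nat) (p : F2P) (k : nat) :
  odd_coef_halved n p -> k.+2 < n -> (p^`()`_k = (p ^+ 2)`_k)%R.
Proof.
move=> p_half lt_k; rewrite coef_deriv.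
have [k2 | k2] : (k = 2 * k./2 \/ k = (2 * k./2).+1) by lia.
  rewrite k2 F2_mulrn_odd F2P_coef_sqr_even p_half //; lia.
rewrite k2 F2P_coef_sqr_odd.
have -> : (2 * k./2).+2 = 2 * (k./2).+1 by lia.
by rewrite F2_mulrn_even.
Qed.

(** Over F_2 a square has zero derivative, so (q^2 p)' = q^2 p' = (q p)^2; the
    coefficient of degree 2m on the left is the one of degree 2m + 1 of q^2 p,
    and on the right it is the one of degree m of q p. *)
Lemma coef_halved_mul_sqr (n : nat) (p q : F2P) (m : nat) :
  odd_coef_halved n p -> (2 * m).+2 < n ->
  ((q ^+ 2 * p)`_(2 * m).+1 = (q * p)`_m)%R.
Proof.
move=> p_half lt_m.
rewrite -[LHS](F2_mulrn_odd _ m) -coef_deriv derivM expr2 derivM.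
rewrite [(q * _^`())%R]mulrC F2P_addrr mul0r add0r -expr2.
rewrite -F2P_coef_sqr_even exprMn !coefM; apply: eq_bigr => i _.
by rewrite (@coef_deriv_halved n) //; lia.
Qed.

(** * The graph on the natural numbers *)

(** The adjacency of G(g, tg) for vertices numbered from 0: the factor t^y of
    g (tg)^y turns degree x - 1 into degree x - y - 1 of g^(y+1).  Working on
    all natural numbers lets the graphs of different sizes, and their shifts by
    powers of 2, be compared without casts. *)
Definition bell_below (p : F2P) (x y : nat) : bool :=
  (y < x) && ((p ^+ y.+1)`_(x - y.+1) == 1)%R.

Definition bell_adj (p : F2P) : rel nat := fun x y =>
  bell_below p x y || bell_below p y x.

Lemma bell_adj_sym (p : F2P) : symmetric (bell_adj p).
Proof. by move=> x y; rewrite /bell_adj orbC. Qed.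

Lemma bell_adj_succ (p : F2P) (x : nat) : (p`_0 = 1)%R -> bell_adj p x.+1 x.
Proof.
by move=> p0; rewrite /bell_adj /bell_below ltnSn subnn F2P_coef0_exp ?eqxx.
Qed.

(** Induction on s through h = y / 2.  With degree d = 2^(s+1) - (y + 1): if y is
    odd then p^(y+1) is the square of p^(h+1) and d is even; if y is even then
    p^(y+1) = (p^h)^2 p and d is odd.  Both reduce to the coefficient of degree
    2^s - (h + 1) in p^(h+1). *)
Lemma bell_hub_coef (n : nat) (p : F2P) (s y : nat) :
    (p`_0 = 1)%R -> odd_coef_halved n p -> 2 ^ s < n -> y < 2 ^ s ->
  ((p ^+ y.+1)`_(2 ^ s - y.+1) = 1)%R.
Proof.
move=> p0 p_half; elim: s y => [|s IHs] y.
  by rewrite expn0; case: y => // _ _; rewrite expr1.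
rewrite expnS => lt_n lt_y; set h := y./2.
have lt_h : h < 2 ^ s by rewrite /h; lia.
rewrite -(IHs h) //; last lia.
have [y2 | y2] : (y = (2 * h).+1 \/ y = 2 * h) by rewrite /h; lia.
  rewrite y2 (_ : (2 * h).+2 = h.+1 * 2); last lia.
  by rewrite exprM (_ : _ - _ = 2 * (2 ^ s - h.+1)) ?F2P_coef_sqr_even //; lia.
rewrite y2 exprSr mulnC exprM.
rewrite (_ : _ - _ = (2 * (2 ^ s - h.+1)).+1); last lia.
by rewrite (@coef_halved_mul_sqr n) ?exprSr //; lia.
Qed.

Lemma bell_hub (n : nat) (p : F2P) (s y : nat) :
    (p`_0 = 1)%R -> odd_coef_halved n p -> 2 ^ s < n -> y < 2 ^ s ->
  bell_adj p (2 ^ s) y.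
Proof.
move=> p0 p_half lt_n lt_y.
by rewrite /bell_adj /bell_below lt_y (@bell_hub_coef n).
Qed.

Lemma bell_adj_shift (p : F2P) (s x y : nat) :
    (p`_0 = 1)%R -> x < 2 ^ s -> y < 2 ^ s ->
  bell_adj p (2 ^ s + x) (2 ^ s + y) = bell_adj p x y.
Proof.
move=> p0 lt_x lt_y; rewrite /bell_adj /bell_below !ltn_add2l -!addnS !subnDl.
by rewrite !F2P_coef_expD //; lia.
Qed.

(** * Short walks through hubs *)

Definition walk_below (e : rel nat) (N d x y : nat) : Prop :=
  exists p, [/\ path e x p, last x p = y, all (gtn N) p & size p <= d].

Lemma walk_below_hub_shift (p : F2P) (s N d x y : nat) :
    (p`_0 = 1)%R -> N <= 2 ^ s -> x < N -> y < N ->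
  walk_below (bell_adj p) N d x y ->
  walk_below (bell_adj p) (2 ^ s + N) d (2 ^ s + x) (2 ^ s + y).
Proof.
move=> p0 leN ltx lty [w [ew lw aw sw]]; exists (map (addn (2 ^ s)) w); split.
- elim: w x ltx ew aw {lw sw} => //= z w IHw x ltx /andP[exz ew] /andP[ltz aw].
  by rewrite bell_adj_shift ?exz ?IHw //; lia.
- by rewrite last_map lw.
- by rewrite all_map (sub_all _ aw) // => z /=; rewrite ltn_add2l.
- by rewrite size_map.
Qed.

(** Strong induction on N, splitting at the hub 2^s with
    2^s < N <= 2^(s+1).  Walks are required to stay below N because the
    part above the hub is a copy of the graph only for vertices below 2^s: a
    walk given by induction has to stay there to be shifted. *)
Lemma bell_walk (n : nat) (p : F2P) (N x y : nat) :
    (p`_0 = 1)%R -> odd_coef_halved n p -> N <= n -> x < N -> y < N ->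
  walk_below (bell_adj p) N (trunc_log 2 N) x y.
Proof.
move=> p0 p_half; elim/ltn_ind: N x y => N IHN x y leN ltx lty.
have [<- | neq_xy] := eqVneq x y; first by exists [::].
have N_gt1 : 1 < N by lia.
(* The logarithm of N - 1 makes the hub a vertex when N is a power of 2 too. *)
set s := trunc_log 2 N.-1.
have lt_hub : 2 ^ s < N.
  by have := @trunc_logP 2 N.-1 isT; rewrite -/s; lia.
have le_hub : N <= 2 ^ s + 2 ^ s.
  by have := @trunc_log_ltn 2 N.-1 isT; rewrite -/s expnS; lia.
have s_gt0 : 0 < 2 ^ s by rewrite expn_gt0.
have hub z : z < 2 ^ s -> bell_adj p (2 ^ s) z.
  by move=> ltz; apply: (@bell_hub n) => //; lia.
have log_half : (trunc_log 2 (N - 2 ^ s)).+1 <= trunc_log 2 N.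
  rewrite (trunc_log2S N_gt1) ltnS; apply: leq_trunc_log; lia.
have upper a b : 2 ^ s <= a < N -> 2 ^ s <= b < N ->
    walk_below (bell_adj p) N (trunc_log 2 (N - 2 ^ s)) a b.
  move=> /andP[lea lta] /andP[leb ltb].
  rewrite -[in X in walk_below _ X](subnKC (ltnW lt_hub)).
  rewrite -[a in walk_below _ _ _ a](subnKC lea).
  rewrite -[b in walk_below _ _ _ _ b](subnKC leb).
  apply: walk_below_hub_shift => //; try lia.
  by apply: IHN; lia.
have [lexs | ltsx] := ltnP x (2 ^ s); have [leys | ltsy] := ltnP y (2 ^ s).
- (* The detour through the hub has length 2, which exceeds floor(log_2 3); for
     N <= 3 two distinct vertices below the hub can only be 0 and 1. *)
  have [N3 | N_gt3] := leqP N 3.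
    have s1 : 2 ^ s = 2 by lia.
    exists [:: y]; split=> //=; rewrite ?lty // ?andbT; last first.
      by rewrite (leq_trans _ log_half).
    have [[-> ->] | [-> ->]] : (x = 0 /\ y = 1) \/ (x = 1 /\ y = 0) by lia.
      by rewrite bell_adj_sym bell_adj_succ.
    by rewrite bell_adj_succ.
  exists [:: 2 ^ s; y]; split=> //=.
  + by rewrite bell_adj_sym !hub.
  + by rewrite lt_hub lty.
  + by have := leq_trunc_log 2 N_gt3.
- have [||w [ew lw aw sw]] := upper (2 ^ s) y; rewrite ?leqnn ?ltsy //.
  exists (2 ^ s :: w); split=> //=.
  + by rewrite bell_adj_sym hub.
  + by rewrite lt_hub.
  + exact: leq_trans log_half.
- have [||w [ew lw aw sw]] := upper x (2 ^ s); rewrite ?leqnn ?ltsx //.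
  exists (rcons w y); split.
  + by rewrite rcons_path ew lw hub.
  + by rewrite last_rcons.
  + by rewrite all_rcons /= lty.
  + by rewrite size_rcons (leq_trans _ log_half).
- have [||w [ew lw aw sw]] := upper x y; rewrite ?ltsx ?ltsy //.
  by exists w; split=> //; rewrite (leq_trans sw) // (leq_trans _ log_half).
Qed.

(** * From integer power series to polynomials over the two-element field *)

(** Truncation turns a series into a polynomial, and no edge among n vertices
    reads a coefficient of degree n or more. *)
Definition mod2_trunc (n : nat) (u : fps) : F2P :=
  \poly_(i < n) ((u i)%:~R)%R.

Definition represents (n : nat) (p : F2P) (u : fps) : Prop :=
  forall k, k < n -> (p`_k = (u k)%:~R)%R.

Lemma mod2_truncP (n : nat) (u : fps) : represents n (mod2_trunc n u) u.
Proof. by move=> k lt_k; rewrite coef_poly lt_k. Qed.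

Lemma represents_mul (n : nat) (p q : F2P) (u v : fps) :
  represents n p u -> represents n q v -> represents n (p * q)%R (fps_mul u v).
Proof.
move=> pu qv k lt_k; rewrite coefM /fps_mul rmorph_sum; apply: eq_bigr => i _.
rewrite rmorphM pu ?qv //; first exact: leq_ltn_trans (leq_subr _ _) lt_k.
exact: leq_ltn_trans (leq_ord i) lt_k.
Qed.

Lemma represents_X (n : nat) : represents n 'X%R fps_X.
Proof. by move=> k _; rewrite coefX /fps_X; case: (k == 1). Qed.

Lemma represents_exp (n : nat) (p : F2P) (u : fps) (m : nat) :
  represents n p u -> represents n (p ^+ m)%R (fps_exp u m).
Proof.
move=> pu; elim: m => [|m IHm]; last by rewrite exprS; exact: represents_mul.
by move=> k _; rewrite coef1 /fps_exp /= /fps_one; case: (k == 0).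
Qed.

Lemma eqz_mod2_F2 (a b : int) :
  (a == b %[mod 2])%Z = ((a%:~R : 'F_2) == b%:~R)%R.
Proof.
by rewrite eqz_mod_dvd (dvdz_pcharf (pchar_Fp (isT : prime 2))) rmorphB subr_eq0.
Qed.

Lemma riordan_entry_bell (n : nat) (g : fps) (x y : nat) :
    y < x < n ->
  riordan_entry g (fps_mul fps_X g) x.+1 y.+1 = bell_below (mod2_trunc n g) x y.
Proof.
move=> /andP[lt_yx lt_xn].
have not_lt : (x.+1 - 2 < y) = false by lia.
have sub_eq : x.+1 - 2 - y = x - y.+1 by lia.
have lt_n : x.+1 - 2 < n by lia.
have gP := mod2_truncP n g.
have fP := represents_mul _ _ _ _ _ (represents_X n) gP.
have entryP := represents_mul _ _ _ _ _ gP (represents_exp _ _ _ y fP).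
rewrite /riordan_entry eqz_mod2_F2 subn1 /= -entryP //.
by rewrite /bell_below lt_yx exprMn mulrCA -exprS coefXnM not_lt sub_eq.
Qed.

Lemma riordan_graph_bell (n : nat) (g : fps) (x y : 'I_n) :
  riordan_graph n g (fps_mul fps_X g) x y = bell_adj (mod2_trunc n g) x y.
Proof.
have entry (a b : 'I_n) :
    (label b < label a) &&
      riordan_entry g (fps_mul fps_X g) (label a) (label b)
    = bell_below (mod2_trunc n g) a b.
  rewrite /label ltnS; case: (ltnP b a) => lt_ba /=.
    by rewrite (@riordan_entry_bell n) // lt_ba ltn_ord.
  by rewrite /bell_below ltnNge lt_ba.
by rewrite /riordan_graph !entry.
Qed.

Lemma F2_eq1_inj (c d : 'F_2) : (c == 1)%R = (d == 1)%R -> c = d.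
Proof.
by move=> cd; apply/eqP; move: cd; case: c d => [[|[|]] ?] // [[|[|]] ?].
Qed.

Lemma bell_adj0 (p : F2P) (k : nat) : bell_adj p k.+1 0 = (p`_k == 1)%R.
Proof. by rewrite /bell_adj /bell_below ltnS subn1 expr1 orbF. Qed.

(** Vertices 2l + 3 and 1 of the graph correspond to vertices l + 2 and 1 of
    the one of half size; the two edges read the coefficients of degree 2l + 1
    and l of g. *)
Lemma io_odd_coef_halved (n : nat) (g : fps) :
    io_decomposable n g (fps_mul fps_X g) ->
  odd_coef_halved n (mod2_trunc n g).
Proof.
case=> _ io_odd _ l lt_l.
have lt0n : 0 < n by lia.
have lt_half : l.+1 < uphalf n by lia.
have lt0half : 0 < uphalf n by lia.
have := io_odd (Ordinal lt_l) (Ordinal lt0n) _ _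
  (Ordinal lt_half) (Ordinal lt0half).
rewrite !inE /label /= !riordan_graph_bell !bell_adj0.
have lt_ln : l < n by lia.
rewrite (mod2_truncP _ g l (ltnW lt_half)) -(mod2_truncP _ g l lt_ln).
by move=> io; apply: F2_eq1_inj; apply: io => //; rewrite ?negbK ?oddM //; lia.
Qed.

Lemma proper_coef0 (n : nat) (g f : fps) :
  0 < n -> riordan_proper g f -> ((mod2_trunc n g)`_0 = 1)%R.
Proof.
move=> n_gt0 [_ /eqP g0 _]; rewrite mod2_truncP //; apply/eqP.
by rewrite -(eqz_mod2_F2 _ 1).
Qed.

Lemma lift_walk_below (n d : nat) (e : rel nat) (x y : 'I_n) :
  walk_below e n d x y -> dist (relpre val e) x y <= d.
Proof.
case=> p [ep lp ap sp].
have [q def_p] : exists q : seq 'I_n, map val q = p.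
  exists (pmap insub p); rewrite (pmap_filter (insubK _)); apply/all_filterP.
  by rewrite (eq_all (isSome_insub _)).
rewrite -def_p size_map in sp; rewrite -def_p path_map in ep.
have <- : last x q = y by apply: val_inj; rewrite /= -last_map def_p.
exact: leq_trans (dist_le_path _ _ _ _ ep) sp.
Qed.

Lemma eq_diam (T : finType) (e e' : rel T) : e =2 e' -> diam e = diam e'.
Proof.
move=> ee'; apply: eq_bigr => x _; apply: eq_bigr => y _.
apply: eq_find => d; apply: eq_existsb => p.
by rewrite (eq_path ee').
Qed.

(** * The diameter *)

Theorem theorem4p22 (n : nat) (g : fps) (hn : 0 < n)
    (hio : io_decomposable n g (fps_mul fps_X g)) :
  diam (riordan_graph n g (fps_mul fps_X g)) <= trunc_log 2 n /\
  (forall k : nat, 1 <= k -> n = 2 ^ k + 2 \/ n = 2 ^ k.+1 + 1 ->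
     diam (riordan_graph n g (fps_mul fps_X g)) = 2).
Proof.
have [g_proper _ io_even] := hio.
set p := mod2_trunc n g.
have p0 : (p`_0 = 1)%R := proper_coef0 _ _ _ hn g_proper.
have p_half : odd_coef_halved n p := io_odd_coef_halved _ _ hio.
have graphE : riordan_graph n g (fps_mul fps_X g) =2 relpre val (bell_adj p).
  by move=> x y; exact: riordan_graph_bell.
split.
  rewrite (eq_diam _ _ _ graphE); apply/diam_leP => x y.
  by apply: lift_walk_below; exact: (@bell_walk n).
move=> k k_gt0 n_eq; have n_ge4 : 3 < n.
  have := leq_pexp2l (isT : 0 < 2) k_gt0; case: n_eq => ->; rewrite ?expnS; lia.
apply/eqP; rewrite eqn_leq; apply/andP; split; last first.
  (* Labels 2 and 4 are both even. *)
  have lt1n : 1 < n by lia.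
  apply: leq_trans (dist_le_diam _ _ (Ordinal lt1n) (Ordinal n_ge4)).
  apply: dist_gt1 => //; apply: io_even; by rewrite inE.
rewrite (eq_diam _ _ _ graphE).
(* The hub, at label 2^k + 1 or 2^(k+1) + 1, is adjacent to all others. *)
have [v lt_v hub] :
    exists2 v, v < n & forall x, x < n -> x != v -> bell_adj p v x.
  case: n_eq => n_eq.
    exists (2 ^ k); first by lia.
    move=> x lt_x neq_x; have [ltx | gtx | eqx] := ltngtP x (2 ^ k).
    - by apply: (@bell_hub n) => //; lia.
    - have -> : x = (2 ^ k).+1 by lia.
      by rewrite bell_adj_sym bell_adj_succ.
    - by rewrite eqx eqxx in neq_x.
  exists (2 ^ k.+1); first by lia.
  by move=> x lt_x neq_x; apply: (@bell_hub n) => //; lia.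
apply: (@diam_universal_vertex _ _ (Ordinal lt_v)) => [x y | x neq_x].
  exact: bell_adj_sym.
exact: hub (ltn_ord x) neq_x.
Qed.
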